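(* Let $X$ be a nonzero finite-dimensional real vector space with norm $\rho$ and dual norm $\rho_*$. Let $\phi:[0,\infty)\to\mathbb{R}$ be finite, convex, and nondecreasing, with $L:=\lim_{r\to\infty}\phi(r)/r\in(0,\infty)$. Let $C_{\phi,\rho}=\{(t,z)\in\mathbb{R}\times X: t\ge\phi(\rho(z))\}$, $\psi(r)=\phi(r)-Lr$ (which is nonincreasing), and $\gamma=\lim_{r\to\infty}\psi(r)\in[-\infty,\infty)$. Then $$C_{\phi,\rho}^\infty=\{(s,w): s\ge L\rho(w)\}.$$ Let $\ell_{a,b}(t,z)=at+b(z)$ with $a>0$, $b\in X^*$, and put $\beta=\rho_*(b)$. Then $$\inf_{C_{\phi,\rho}}\ell_{a,b}=\inf_{r\ge0}\{a\phi(r)-\beta r\}.$$ Consequently: (i) if $\beta>aL$, the value $\inf_{C_{\phi,\rho}}\ell_{a,b}$ is $-\infty$; (ii) if $\beta<aL$, the scalar objective $r\mapsto a\phi(r)-\beta r$ is coercive on $[0,\infty)$ and the minimum of $\ell_{a,b}$ over $C_{\phi,\rho}$ is attained; (iii) if $\beta=aL$, the value is $a\gamma$. If $\gamma=-\infty$, the problem is unbounded below. If $\gamma\in\mathbb{R}$, the value is attained if and only if $\psi(r)=\gamma$ for some finite $r\ge0$, equivalently if and only if $\phi$ is eventually affine with slope $L$. Otherwise the value is finite and unattained. Thus copositivity of $\ell_{a,b}$ on $C_{\phi,\rho}^\infty$ is equivalent to $aL\ge\beta$, but at equality $aL=\beta$ it does not decide boundedness or attainment.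
   Context: The dual norm is $\rho_*(b)=\sup\{b(z):\rho(z)\le1\}$ for $b\in X^*$. For a nonempty closed convex set $C$, the recession cone is $C^\infty=\{d: x+\lambda d\in C\ \forall x\in C,\ \forall\lambda\ge0\}$. A linear functional $c$ is copositive on $C^\infty$ if $c(d)\ge0$ for all $d\in C^\infty$. *)

(* Defs.v *)
From HB Require Import structures.
From mathcomp Require Import all_boot all_order all_algebra.
From mathcomp Require Import all_classical all_reals all_analysis.

Set Implicit Arguments.
Unset Strict Implicit.
Unset Printing Implicit Defensive.

Import Order.TTheory GRing.Theory Num.Theory.
Import numFieldNormedType.Exports.

Local Open Scope classical_set_scope.
Local Open Scope ring_scope.

Section Norms.
Context {R : realType} {X : vectType R}.

(* The same fields as [Lmodule_isNormed]; nonnegativity follows from them. A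
   predicate is used because a [vectType] carries no norm in the library. *)
Record is_norm (rho : X -> R) : Prop := IsNorm {
  is_norm_triangle : forall x y, rho (x + y) <= rho x + rho y ;
  is_norm_scale : forall (l : R) x, rho (l *: x) = `|l| * rho x ;
  is_norm_eq0 : forall x, rho x = 0 -> x = 0
}.

(* [X] is finite-dimensional, so for a norm the set below is bounded and the
   real supremum is never the default value of [sup]. *)
Definition dual_norm (rho : X -> R) (b : 'Hom(X, R^o)) : R :=
  sup [set (b z : R) | z in [set z | rho z <= 1]].

End Norms.

Section Cones.
Context {R : realType} {E : lmodType R}.

Definition recession_cone (C : set E) : set E :=
  [set d | forall x, C x -> forall l : R, 0 <= l -> C (x + l *: d)].

Definition copositive (c : {linear E -> R^o}) (K : set E) : Prop :=
  forall d, K d -> 0 <= (c d : R).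

End Cones.

Section Minimization.
Context {R : realType} {T : Type}.
Implicit Types (A : set T) (f : T -> R).

Definition inf_on A f : \bar R := ereal_inf [set (f x)%:E | x in A].

Definition attained_on A f : Prop := exists2 x, A x & (f x)%:E = inf_on A f.

Definition unbounded_below_on A f : Prop :=
  forall M : R, exists2 x, A x & f x < M.

End Minimization.

Section Profiles.
Context {R : realType}.
Implicit Types (phi : R -> R) (L : R).

(* A function on [0, +oo[ is represented by a total function of which only the
   values on [0, +oo[ are ever constrained or used. *)
Record profile phi L : Prop := Profile {
  profile_convex : convex_function (E := R^o) `[0, +oo[%classic phi ;
  profile_nondecreasing : {in `[0, +oo[ &, nondecreasing_fun phi} ;
  profile_slope : phi r / r @[r --> +oo] --> L ;
  profile_slope_gt0 : 0 < L
}.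

Definition recession_gap phi L (r : R) : R := phi r - L * r.

Definition gap_limit phi L : \bar R :=
  lim ((recession_gap phi L r)%:E @[r --> +oo]).

Definition eventually_affine phi L : Prop :=
  exists c : R, \forall r \near +oo, phi r = L * r + c.

End Profiles.

Section Epigraph.
Context {R : realType} {X : vectType R}.

Definition norm_epigraph (phi : R -> R) (rho : X -> R) :
    set (R^o * X)%type :=
  [set p | phi (rho p.2) <= p.1].

Definition ell (a : R) (b : 'Hom(X, R^o)) (p : (R^o * X)%type) : R^o :=
  a * p.1 + b p.2.

Fact ell_is_linear a b : linear (ell a b).
Proof.
move=> k [s z] [t w]; rewrite /ell /= linearP /= scalerDr mulrDr addrACA.
by rewrite /GRing.scale /= mulrCA.
Qed.

HB.instance Definition _ a b :=
  GRing.isLinear.Build R (R^o * X)%type R^o _ (ell a b) (ell_is_linear a b).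

End Epigraph.

(* Main.v *)
(** Homogeneity reduces the minimization of [a t + b z] over the epigraph to
    the half-line: on the sphere [rho z = r] the functional [b] has minimum
    [- beta r], attained because the unit ball of a finite-dimensional norm is
    compact. Since [phi] is convex with asymptotic slope [L], no chord of [phi]
    is steeper than [L]; hence [psi] is nonincreasing, [gamma] is its infimum,
    and [phi] is Lipschitz on the half-line. At [beta = a L] the scalar
    objective is [a psi]. With [u = sqrt (1 + r)], the profiles [L (r - 2 u)],
    [L (r + 1 / u^2)] and [L r] show that at equality the problem can be
    unbounded, bounded but unattained, or attained. *)

Require Import Defs.
From mathcomp Require Import all_boot all_order all_algebra.
From mathcomp Require Import all_classical all_reals all_analysis.
From mathcomp Require Import ring lra.

Import Order.TTheory GRing.Theory Num.Theory.
Import numFieldNormedType.Exports.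

Local Open Scope classical_set_scope.
Local Open Scope ring_scope.

(** * Finite-dimensional norms and attainment of the dual norm *)

Section DualNorm.
Import VectorInternalTheory.
Set Implicit Arguments.
Unset Strict Implicit.
Context {R : realType}.

Lemma lipschitz_continuous (V W : normedModType R) (f : V -> W) (M : R) :
  (forall x y, `|f x - f y| <= M * `|x - y|) -> continuous f.
Proof.
move=> fM x; apply/cvgrPdist_le => e e0; near=> y.
apply: (le_trans (fM x y)).
(* [M] may be zero or negative, so a positive bound replaces it before dividing. *)
apply: (@le_trans _ _ ((`|M| + 1) * `|x - y|)).
  by rewrite ler_wpM2r// (le_trans (ler_norm M))// lerDl.
rewrite -ler_pdivlMl ?ltr_wpDl//; near: y.
by apply: cvgr_dist_le; [exact: cvg_id | rewrite mulr_gt0// invr_gt0 ltr_wpDl].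
Unshelve. all: end_near. Qed.

(** Expand in the standard basis: each coordinate is at most the sup norm. The seminorm form covers
    both [rho] and [|b|]. *)
Lemma seminorm_rV_bounded n (N : 'rV[R]_n -> R) :
  (forall x y, N (x + y) <= N x + N y) ->
  (forall l x, N (l *: x) = `|l| * N x) ->
  exists M, forall x, N x <= M * `|x|.
Proof.
move=> ND NZ; exists (\sum_i N (delta_mx 0 i)) => x.
have N0 : N 0 = 0 by rewrite -(scale0r 0) NZ normr0 mul0r.
have N_ge0 y : 0 <= N y.
  have := ND y (- y); rewrite subrr N0 -scaleN1r NZ normrN1 mul1r -mulr2n.
  by rewrite pmulrn_lge0.
have coord_le i : `|x 0 i| <= `|x|.
  rewrite [leRHS]/Num.Def.normr /= mx_normrE.
  exact: (le_bigmax _ (fun ij : 'I_1 * 'I_n => `|x ij.1 ij.2|) (0, i)).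
rewrite [in N x](row_sum_delta x) mulr_suml.
apply: (@le_trans _ _ (\sum_i N (x 0 i *: delta_mx 0 i))).
  elim/big_ind2 : _ => [|u v w t uv wt|//]; first by rewrite N0.
  by rewrite (le_trans (ND _ _))// lerD.
by apply: ler_sum => i _; rewrite NZ mulrC ler_wpM2l.
Qed.

Context {X : vectType R} {rho : X -> R}.
Hypothesis rho_norm : is_norm rho.

Lemma is_norm0 : rho 0 = 0.
Proof. by rewrite -(scale0r 0) (is_norm_scale rho_norm) normr0 mul0r. Qed.

Lemma is_normN x : rho (- x) = rho x.
Proof. by rewrite -scaleN1r (is_norm_scale rho_norm) normrN1 mul1r. Qed.

Lemma is_norm_ge0 x : 0 <= rho x.
Proof.
have := is_norm_triangle rho_norm x (- x).
by rewrite subrr is_norm0 is_normN -mulr2n pmulrn_lge0.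
Qed.

Lemma is_norm_gt0 x : x != 0 -> 0 < rho x.
Proof.
move=> x0; rewrite lt_neqAle is_norm_ge0 andbT eq_sym.
by apply: contra_neq x0; exact: is_norm_eq0.
Qed.

(** Continuity is taken in coordinates, where the sup norm gives the topology; it follows from the
    reverse triangle inequality and the seminorm bound. *)
Lemma is_norm_continuous : continuous (rho \o r2v).
Proof.
have ND (x y : 'rV_(dim X)) :
    (rho \o r2v) (x + y) <= (rho \o r2v) x + (rho \o r2v) y.
  by rewrite /= linearD; exact: is_norm_triangle.
have NZ l (x : 'rV_(dim X)) : (rho \o r2v) (l *: x) = `|l| * (rho \o r2v) x.
  by rewrite /= linearZ; exact: is_norm_scale.
have [M NM] := seminorm_rV_bounded ND NZ.
have dist_le x y : (rho \o r2v) x - (rho \o r2v) y <= M * `|x - y|.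
  by rewrite lerBlDr -{1}(subrK y x) (le_trans (ND _ _))// lerD2r.
apply: (@lipschitz_continuous _ R^o _ M) => x y.
by rewrite ler_norml dist_le lerNl opprB distrC dist_le.
Qed.

Lemma hom_continuous (b : 'Hom(X, R^o)) :
  continuous (fun x : 'rV[R]_(dim X) => (b (r2v x) : R)).
Proof.
have ND (x y : 'rV_(dim X)) :
    `|b (r2v (x + y))| <= `|b (r2v x)| + `|b (r2v y)|.
  by rewrite 2!linearD ler_normD.
have NZ l (x : 'rV_(dim X)) : `|b (r2v (l *: x))| = `|l| * `|b (r2v x)|.
  by rewrite 2!linearZ normrZ.
have [M bM] := seminorm_rV_bounded ND NZ.
apply: (@lipschitz_continuous _ R^o _ M) => x y.
rewrite /= -linearB -linearB; exact: bM.
Qed.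

Lemma dual_norm_eq (b : 'Hom(X, R^o)) (z : X) : rho z = 1 ->
  (forall y, (b y : R) <= b z * rho y) -> dual_norm rho b = b z.
Proof.
(* Comparing [z] with [- z] gives the sign that turns [rho y <= 1] into [b y <= b z]. *)
move=> z1 bz; have bz_ge0 : 0 <= (b z : R).
  have := bz (- z); rewrite is_normN z1 mulr1 linearN /=.
  by rewrite -subr_ge0 opprK -mulr2n pmulrn_lge0.
apply/eqP; rewrite eq_le; apply/andP; split.
  apply: ge_sup; first by exists (b z), z; rewrite //= z1.
  by move=> _ [y /= y1 <-]; rewrite (le_trans (bz y))// ler_piMr.
apply: sup_upper_bound; last by exists z; rewrite //= z1.
split; first by exists (b z), z; rewrite //= z1.
by exists (b z) => _ [y /= y1 <-]; rewrite (le_trans (bz y))// ler_piMr.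
Qed.

Hypothesis X_neq0 : (0 < \dim {:X})%N.

(* The quotient [b / rho] is homogeneous of degree 0, so its maximum over the
   compact unit sphere of the sup norm in coordinates is its global maximum. *)
Lemma dual_norm_attained (b : 'Hom(X, R^o)) : exists z,
  [/\ rho z = 1, (b z : R) = dual_norm rho b
    & forall y, (b y : R) <= dual_norm rho b * rho y].
Proof.
pose S : set 'rV[R]_(dim X) := [set x | `|x| = 1].
have Sneq0 x : S x -> r2v x != 0 :> X.
  move=> /= x1; apply/eqP => /(congr1 v2r); rewrite r2vK linear0 => x0.
  by move: x1; rewrite /S /= x0 normr0 => /esym/eqP; rewrite oner_eq0.
have normS x : x != 0 -> S (`|x|^-1 *: x).
  move=> x0; rewrite /S /= normrZ normfV normr_id mulVf//.
  by rewrite normr_eq0.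
have S0 : S !=set0.
  have : vpick {:X} != 0 by rewrite vpick0 -dimv_eq0 -lt0n.
  move=> v0; exists (`|v2r (vpick {:X})|^-1 *: v2r (vpick {:X})).
  by apply: normS; apply: contra_neq v0 => /(congr1 r2v); rewrite v2rK linear0.
have cS : compact S.
  apply: bounded_closed_compact.
    by exists 1; split => // x x1 y /= ->; exact: ltW.
  have -> : S = (fun x => `|x|) @^-1` [set 1 : R] by [].
  apply: preimage_closed; last exact: closed_eq.
  by move=> x _; exact: norm_continuous.
pose q (x : 'rV[R]_(dim X)) : R := (b (r2v x) : R) / rho (r2v x).
have cq : {within S, continuous q}.
  apply: continuous_in_subspaceT => x /set_mem xS.
  have cV : {for x, continuous (fun y : 'rV[R]_(dim X) => (rho (r2v y))^-1)}.
    apply: continuousV; last exact: is_norm_continuous.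
    by rewrite gt_eqF// is_norm_gt0// Sneq0.
  exact: (continuousM (@hom_continuous b x) cV).
have [c /set_mem cS1 cmax] := compact_EVT_max S0 cS cq.
have rc0 : 0 < rho (r2v c) by rewrite is_norm_gt0// Sneq0.
pose z := (rho (r2v c))^-1 *: r2v c.
have z1 : rho z = 1.
  by rewrite (is_norm_scale rho_norm) normfV (gtr0_norm rc0) mulVf// gt_eqF.
have bz y : (b y : R) <= b z * rho y.
  have [->|y0] := eqVneq y 0; first by rewrite linear0 is_norm0 mulr0.
  rewrite -ler_pdivrMr ?is_norm_gt0//.
  have vy0 : v2r y != 0.
    by apply: contra_neq y0 => /(congr1 r2v); rewrite v2rK linear0.
  have ny : 0 < `|v2r y| by rewrite normr_gt0.
  have /cmax : `|v2r y|^-1 *: v2r y \in S by apply/mem_set/normS.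
  rewrite /q [r2v _]linearZ /= v2rK linearZ (is_norm_scale rho_norm) /=.
  rewrite normfV normr_id -mulf_div mulfV ?mul1r ?gt_eqF ?invr_gt0//.
  by move/le_trans; apply; rewrite /z linearZ /= [leRHS]mulrC.
by exists z; rewrite (dual_norm_eq z1 bz).
Qed.

Lemma dual_norm_surjective (c : R) : 0 <= c ->
  exists b : 'Hom(X, R^o), dual_norm rho b = c.
Proof.
move=> c_ge0; pose v := vpick {:X}.
have v0 : v != 0 by rewrite vpick0 -dimv_eq0 -lt0n.
(* A nonzero vector has a nonzero coordinate; the corresponding coordinate functional will be
   rescaled to dual norm [c]. *)
have [i vi] : exists i, coord (vbasis {:X}) i v != 0.
  apply/existsP; rewrite -[X in is_true X]negbK negb_exists.
  apply: contra v0 => /forallP vi0.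
  rewrite (coord_vbasis (memvf v)) big1// => i _.
  by have := vi0 i; rewrite negbK => /eqP ->; rewrite scale0r.
pose b0 : 'Hom(X, R^o) := linfun (coord (vbasis {:X}) i).
have [z [z1 zE zmax]] := dual_norm_attained b0.
have beta0 : 0 < dual_norm rho b0.
  (* One of [b0 v] and [- b0 v] is positive, and both are at most [dual_norm rho b0 * rho v]. *)
  have := zmax v; have := zmax (- v); rewrite linearN /= is_normN.
  have bv : (b0 v : R) != 0 by rewrite lfunE.
  have := is_norm_gt0 v0; move: bv; nra.
exists ((c / dual_norm rho b0) *: b0).
have scaleE y : (((c / dual_norm rho b0) *: b0) y : R)
    = c / dual_norm rho b0 * (b0 y : R) by rewrite scale_lfunE.
rewrite (dual_norm_eq z1) scaleE zE ?divfK ?gt_eqF// => y.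
rewrite scaleE (le_trans (ler_wpM2l _ (zmax y))) ?divr_ge0 ?(ltW beta0)//.
by rewrite mulrA divfK ?gt_eqF.
Qed.

End DualNorm.

(** * Convex profiles with asymptotic slope [L] *)

Section Profile.
Set Implicit Arguments.
Unset Strict Implicit.
Context {R : realType} {phi : R -> R} {L : R}.
Hypothesis prof : profile phi L.
Local Notation psi := (recession_gap phi L).
Local Notation infpsi := (inf_on `[0, +oo[%classic psi).

(** With [m] halfway between [k] and [L], eventually [phi r >= m r], so the difference is at least
    [(m - k) r]. *)
Lemma profile_subr_cvgy k : k < L -> phi r - k * r @[r --> +oo] --> +oo.
Proof.
move=> kL; apply/cvgryPge => A; pose m := (k + L) / 2.
have mk : 0 < m - k by rewrite /m; lra.
have mL : m < L by rewrite /m; lra.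
near=> r.
have r0 : 0 < r by [].
have : m <= phi r / r by near: r; exact: cvgr_ge (profile_slope prof) _ mL.
have : A / (m - k) <= r by near: r; apply: nbhs_pinfty_ge; exact: num_real.
by rewrite ler_pdivrMr// ler_pdivlMr//; lra.
Unshelve. all: end_near. Qed.

Lemma profile_subr_cvgNy k : L < k -> phi r - k * r @[r --> +oo] --> -oo.
Proof.
move=> kL; apply/cvgrNyPle => A; pose m := (k + L) / 2.
have mk : 0 < k - m by rewrite /m; lra.
have mL : L < m by rewrite /m; lra.
near=> r.
have r0 : 0 < r by [].
have : phi r / r <= m by near: r; exact: cvgr_le (profile_slope prof) _ mL.
have : - A / (k - m) <= r by near: r; apply: nbhs_pinfty_ge; exact: num_real.
by rewrite ler_pdivrMr// ler_pdivrMr//; lra.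
Unshelve. all: end_near. Qed.

Lemma profile_convexP x y t : 0 <= x -> 0 <= y -> 0 <= t <= 1 ->
  phi (t * x + (1 - t) * y) <= t * phi x + (1 - t) * phi y.
Proof.
move=> x0 y0 /andP[t0 t1].
have := profile_convex prof (Itv01 t0 t1) (x := x) (y := y).
by rewrite !inE /= !in_itv /= x0 y0 => /(_ isT isT).
Qed.

Lemma profile_nondecr r s : 0 <= r -> r <= s -> phi r <= phi s.
Proof.
move=> r0 rs; apply: (profile_nondecreasing prof) => //.
  by rewrite in_itv /= r0.
by rewrite in_itv /= (le_trans r0 rs).
Qed.

(* A chord of slope [m > L] would force [phi t >= phi r + m (t - r)] beyond it,
   contradicting the asymptotic slope [L]. *)
Lemma recession_gap_nonincr r s : 0 <= r -> r <= s -> psi s <= psi r.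
Proof.
move=> r0; rewrite le_eqVlt => /predU1P[->//|rs].
rewrite leNgt; apply/negP; rewrite /recession_gap => psi_lt.
have sr : 0 < s - r by rewrite subr_gt0.
pose m := (phi s - phi r) / (s - r).
have mE : m * (s - r) = phi s - phi r by rewrite divfK// gt_eqF.
have Lm : L < m by rewrite ltr_pdivlMr//; lra.
(* As [m > L], some [t > s] has [phi t] below the line through the chord from [r] to [s]; convexity
   on [[r, t]] forbids this. *)
have /cvgrNyPlt/(_ (phi r - m * r)) := profile_subr_cvgNy Lm.
move=> /pinfty_ex_gt -/(_ s (num_real _))[t st]; apply/negP; rewrite -leNgt.
have tr : 0 < t - r by lra.
have t_r : t - r != 0 by rewrite gt_eqF.
have t0 : 0 <= t by lra.
have t01 : 0 <= (t - s) / (t - r) <= 1.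
  by rewrite divr_ge0 ?ler_pdivrMr//=; lra.
have := profile_convexP r0 t0 t01.
have -> : (t - s) / (t - r) * r + (1 - (t - s) / (t - r)) * t = s by field.
have -> : 1 - (t - s) / (t - r) = (s - r) / (t - r) by field.
have -> : (t - s) / (t - r) * phi r + (s - r) / (t - r) * phi t
  = ((t - s) * phi r + (s - r) * phi t) / (t - r) by field.
rewrite ler_pdivlMr// => h.
have : (s - r) * (phi r - m * r) <= (s - r) * (phi t - m * t).
  by move: h mE; nra.
by rewrite ler_pM2l.
Qed.

Lemma profile_lipschitz r s : 0 <= r -> r <= s ->
  0 <= phi s - phi r <= L * (s - r).
Proof.
move=> r0 rs; rewrite subr_ge0 profile_nondecr//=.
by have := recession_gap_nonincr r0 rs; rewrite /recession_gap; lra.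
Qed.

(** A nonincreasing function tends to its infimum, finite or [-oo]. This lets [gamma] be handled as
    an infimum from here on. *)
Lemma recession_gap_cvg : (psi r)%:E @[r --> +oo] --> infpsi.
Proof.
have lb r : 0 <= r -> (infpsi <= (psi r)%:E)%E.
  by move=> r0; apply: ereal_inf_lbound; exists r; rewrite //= in_itv /= r0.
have ev A : (infpsi < A%:E)%E -> \forall r \near +oo, psi r < A.
  move=> /ereal_inf_lt[_ [r /= + <-]]; rewrite in_itv andbT lte_fin /= => r0 rA.
  apply: filterS (nbhs_pinfty_ge (num_real r)) => s rs.
  exact: le_lt_trans (recession_gap_nonincr r0 rs) rA.
case gE : infpsi lb ev => [g||] lb ev.
- apply: cvg_EFin; first by near=> r.
  apply/cvgrPdist_le => e e0; near=> r.
  have gr : g <= psi r by rewrite -lee_fin lb.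
  rewrite distrC ger0_norm ?subr_ge0// lerBlDl ltW//.
  by near: r; apply: ev; rewrite lte_fin ltrDl.
- by have := lb 0 (lexx 0).
- by apply/cvgeNyPlt => A; near do rewrite lte_fin; apply: ev; rewrite ltNyr.
Unshelve. all: end_near. Qed.

Lemma gap_limitE : gap_limit phi L = infpsi.
Proof. by apply: cvg_lim recession_gap_cvg. Qed.

Lemma gap_limit_lty : (gap_limit phi L < +oo)%E.
Proof.
rewrite gap_limitE (@le_lt_trans _ _ (psi 0)%:E) ?ltry//.
by apply: ereal_inf_lbound; exists 0; rewrite //= in_itv /= lexx.
Qed.

(** Once [psi] reaches its infimum, monotonicity freezes it there. Conversely, if [psi] is
    eventually constant, that constant lies below every earlier value. *)
Lemma gap_attainedP : (exists2 r, 0 <= r & (psi r)%:E = gap_limit phi L) <->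
  eventually_affine phi L.
Proof.
rewrite gap_limitE; split => [[r r0 psir]|[c /pinfty_ex_gt]].
  exists (psi r); near=> s.
  have rs : r <= s by near: s; apply: nbhs_pinfty_ge; exact: num_real.
  have : psi s = psi r; last by rewrite /recession_gap; lra.
  apply/eqP; rewrite eq_le recession_gap_nonincr//= -lee_fin psir.
  apply: ereal_inf_lbound; exists s => //=.
  by rewrite in_itv /= (le_trans r0 rs).
move=> exgt; have [r r0 phir] := exgt 0 (num_real _).
exists r; first exact: ltW.
apply/eqP; rewrite eq_le; apply/andP; split; last first.
  by apply: ereal_inf_lbound; exists r; rewrite //= in_itv /= ltW.
apply: le_ereal_inf_tmp => _ [s /= + <-]; rewrite in_itv andbT /= => s0.
have [t st phit] := exgt s (num_real _).
have := recession_gap_nonincr s0 (ltW st).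
by rewrite lee_fin /recession_gap phir phit; lra.
Unshelve. all: end_near. Qed.

Lemma profile_coercive a beta : 0 < a -> beta < a * L ->
  a * phi r - beta * r @[r --> +oo] --> +oo.
Proof.
move=> a0 betaL; have betaaL : beta / a < L by rewrite ltr_pdivrMr// mulrC.
rewrite (_ : (fun r => _) = (fun r => a * (phi r - beta / a * r))); last first.
  apply/funext => r.
  by field; rewrite gt_eqF.
exact: gt0_cvgMry a0 (profile_subr_cvgy betaaL).
Qed.

(** [phi] is constrained only on the half-line, so it is extended to the left by the constant
    [phi 0]; the extension is [L]-Lipschitz on the whole line. *)
Lemma profile_max0_continuous : continuous (fun r : R => phi (Num.max 0 r)).
Proof.
have step x y : x <= y ->
    `|phi (Num.max 0 x) - phi (Num.max 0 y)| <= L * `|x - y|.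
  move=> xy; have mxy : Num.max 0 x <= Num.max 0 y.
    by rewrite ge_max le_max lexx/= le_max xy orbT.
  have m0 : 0 <= Num.max 0 x by rewrite le_max lexx.
  have /andP[h1 h2] := profile_lipschitz m0 mxy.
  rewrite distrC ger0_norm// (le_trans h2)//.
  rewrite ler_wpM2l ?(ltW (profile_slope_gt0 prof))//.
  rewrite distrC ger0_norm ?subr_ge0//.
  by rewrite !maxEle; case: (leP 0 x) => ?; case: (leP 0 y) => ?; lra.
apply: (@lipschitz_continuous _ R^o R^o _ L) => x y.
have [xy|/ltW yx] := leP x y; first exact: step.
by rewrite distrC [`|x - y|]distrC step.
Qed.

Lemma profile_scalar_min a beta : 0 < a -> beta < a * L ->
  exists2 r0, 0 <= r0 &
    forall r, 0 <= r -> a * phi r0 - beta * r0 <= a * phi r - beta * r.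
Proof.
move=> a0 betaL; pose g r := a * phi r - beta * r.
(* Beyond [M] the objective is at least its value at [0], so it is enough to minimize on
   [[0, max 0 M]]. *)
have /cvgryPge/(_ (g 0))[M [_ gM]] := profile_coercive a0 betaL.
pose h r := a * phi (Num.max 0 r) - beta * r.
have hE r : 0 <= r -> h r = g r by move=> r0; rewrite /h max_r.
have ch : continuous h.
  move=> r; apply: cvgB; apply: cvgM; try exact: cvg_cst.
    exact: profile_max0_continuous.
  exact: cvg_id.
have M0 : 0 <= Num.max 0 M by rewrite le_max lexx.
have [c + cmin] := EVT_min M0 (continuous_subspaceT ch).
rewrite in_itv /= => /andP[c0 _]; exists c => // r r0.
rewrite -/(g c) -/(g r) -!hE//.
have [rM|Mr] := leP r (Num.max 0 M); first by rewrite cmin// in_itv /= r0.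
apply: (@le_trans _ _ (h 0)); first by rewrite cmin// in_itv /= lexx.
by rewrite !hE// gM// (le_lt_trans _ Mr)// le_max lexx orbT.
Qed.

End Profile.

Lemma unbounded_below_inf_on (R : realType) (T : Type) (A : set T)
    (f : T -> R) :
  inf_on A f = -oo%E -> unbounded_below_on A f.
Proof.
move=> fA M; have : (inf_on A f < M%:E)%E by rewrite fA ltNyr.
by move=> /ereal_inf_lt[_ [x Ax <-]]; rewrite lte_fin => fM; exists x.
Qed.

(** * Linear minimization over the epigraph, reduced to the half-line *)

Section Epigraph.
Set Implicit Arguments.
Unset Strict Implicit.
Context {R : realType} {X : vectType R} {rho : X -> R}.
Hypotheses (rho_norm : is_norm rho) (X_neq0 : (0 < \dim {:X})%N).
Context {phi : R -> R} {L : R}.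
Hypothesis prof : profile phi L.
Local Notation C := (norm_epigraph phi rho).

(** From the point [(phi 0, 0)], a direction with [s < L rho w] would force
    [phi r <= phi 0 + (s / rho w) r] for all [r > 0], contradicting the slope [L]. Conversely, [phi]
    grows at rate at most [L], so such directions never leave the epigraph. *)
Lemma recession_cone_epigraph :
  recession_cone C = [set p | L * rho p.2 <= p.1].
Proof.
apply/seteqP; split => [[s w] /= rec|[s w] /= sw [t z] /= tz l l0].
- have [w0|w0] := eqVneq w 0.
    have := rec (phi 0, 0); rewrite /norm_epigraph /= (is_norm0 rho_norm) lexx.
    move=> /(_ isT 1 ler01); rewrite /= w0 scaler0 addr0 (is_norm0 rho_norm).
    by rewrite mulr0 scale1r lerDl.
  have rw : 0 < rho w by exact: is_norm_gt0.
  rewrite leNgt; apply/negP => sL.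
  have /(profile_subr_cvgy prof) : s / rho w < L by rewrite ltr_pdivrMr.
  move=> /cvgryPgt/(_ (phi 0))/pinfty_ex_gt -/(_ 0 (num_real _))[r r0].
  apply/negP; rewrite -leNgt.
  have := rec (phi 0, 0); rewrite /norm_epigraph /= (is_norm0 rho_norm) lexx.
  (* The step length [r / rho w] brings the second component to norm [r]. *)
  move=> /(_ isT (r / rho w)); rewrite divr_ge0 ?(ltW r0) ?(ltW rw)//.
  move=> /(_ isT); rewrite /= add0r (is_norm_scale rho_norm) ger0_norm.
    rewrite divfK ?gt_eqF// lerBlDr => /le_trans; apply.
    by rewrite lerD2l /GRing.scale /= [leLHS]mulrAC [r * s]mulrC mulrAC.
  by rewrite divr_ge0 ?(ltW r0) ?(ltW rw).
- rewrite /norm_epigraph /=.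
  have rzw : rho (z + l *: w) <= rho z + l * rho w.
    rewrite (le_trans (is_norm_triangle rho_norm _ _))//.
    by rewrite (is_norm_scale rho_norm) ger0_norm.
  have lw0 : 0 <= l * rho w by rewrite mulr_ge0// is_norm_ge0.
  have z0 : 0 <= rho z by rewrite is_norm_ge0.
  have := profile_nondecr prof (is_norm_ge0 rho_norm _) rzw.
  have := profile_lipschitz prof z0 (_ : rho z <= rho z + l * rho w).
  rewrite lerDl => /(_ lw0)/andP[_ h] /le_trans; apply.
  have : l * (L * rho w) <= l * s by rewrite ler_wpM2l.
  by rewrite /GRing.scale /=; move: h tz; rewrite /norm_epigraph /=; lra.
Qed.

Context {a : R} {b : 'Hom(X, R^o)}.
Hypothesis a_gt0 : 0 < a.
Local Notation beta := (dual_norm rho b).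
Local Notation objective := (fun r => a * phi r - beta * r).

Lemma hom_dual_normN y : - (dual_norm rho b * rho y) <= (b y : R).
Proof.
have [z [_ _ bz]] := dual_norm_attained rho_norm X_neq0 b.
by have := bz (- y); rewrite (is_normN rho_norm) linearN lerNl.
Qed.

Lemma ell_ge_objective p : C p -> objective (rho p.2) <= ell a b p.
Proof.
move=> Cp; rewrite /ell lerD ?hom_dual_normN//.
by rewrite ler_pM2l.
Qed.

(** The witness is the boundary point over [- r z], where [z] is a unit vector with [b z = beta].
    Attainment of the dual norm is what carries scalar minimizers over to the epigraph. *)
Lemma ell_eq_objective r : 0 <= r -> exists2 p, C p & ell a b p = objective r.
Proof.
move=> r0; have [z [z1 bz _]] := dual_norm_attained rho_norm X_neq0 b.
have rz : rho (- r *: z) = r.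
  by rewrite (is_norm_scale rho_norm) normrN ger0_norm// z1 mulr1.
exists (phi r, - r *: z); first by rewrite /norm_epigraph /= rz.
by rewrite /ell /= linearZ /= bz scaleNr [beta * r]mulrC.
Qed.

Lemma inf_on_epigraph : inf_on C (ell a b) = inf_on `[0, +oo[%classic objective.
Proof.
apply/eqP; rewrite eq_le; apply/andP; split.
- apply: le_ereal_inf_tmp => _ [r /= + <-]; rewrite in_itv andbT /= => r0.
  have [p Cp <-] := ell_eq_objective r0.
  by apply: ereal_inf_lbound; exists p.
- apply: le_ereal_inf_tmp => _ [p Cp <-].
  rewrite (@le_trans _ _ (objective (rho p.2))%:E) ?lee_fin ?ell_ge_objective//.
  apply: ereal_inf_lbound; exists (rho p.2) => //=.
  by rewrite in_itv /= is_norm_ge0.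
Qed.

(** If [p] attains the infimum, the objective at [rho p.2] is squeezed between the infimum and
    [ell a b p]. *)
Lemma attained_on_epigraph : attained_on C (ell a b) <->
  exists2 r, 0 <= r & (objective r)%:E = inf_on C (ell a b).
Proof.
split=> [[p Cp pE]|[r r0 rE]].
- exists (rho p.2); first exact: is_norm_ge0.
  apply/eqP; rewrite eq_le -{1}pE lee_fin ell_ge_objective//= inf_on_epigraph.
  apply: ereal_inf_lbound; exists (rho p.2) => //=.
  by rewrite in_itv /= is_norm_ge0.
- by have [p Cp pE] := ell_eq_objective r0; exists p; rewrite ?pE.
Qed.

(** On the boundary direction [(L, - z)], with [z] a unit maximizer of [b], the functional equals
    [a L - beta]; the dual norm bound controls all other directions. *)
Lemma copositive_ell :
  copositive (ell a b) (recession_cone C) <-> beta <= a * L.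
Proof.
rewrite recession_cone_epigraph; split=> [cop|bL [s w] /= sw].
- have [z [z1 bz _]] := dual_norm_attained rho_norm X_neq0 b.
  have := cop (L, - z); rewrite /= (is_normN rho_norm) z1 mulr1.
  move=> /(_ (lexx _)).
  by rewrite /ell /= linearN /= bz subr_ge0.
- have := hom_dual_normN w; have w0 := is_norm_ge0 rho_norm w.
  have : a * (L * rho w) <= a * s by rewrite ler_pM2l.
  have : beta * rho w <= a * L * rho w by rewrite ler_wpM2r.
  by rewrite /ell /=; lra.
Qed.

Lemma inf_on_epigraph_supercritical : a * L < beta ->
  inf_on C (ell a b) = -oo%E.
Proof.
move=> Lb; have bL : L < beta / a by rewrite ltr_pdivlMr// mulrC.
apply: eq_ninfty => M.
have /cvgrNyPle/(_ (M / a)) := profile_subr_cvgNy prof bL.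
move=> /pinfty_ex_gt -/(_ 0 (num_real _))[r r0].
rewrite ler_pdivlMr// mulrBl mulrAC divfK ?gt_eqF// [phi r * a]mulrC => gM.
rewrite inf_on_epigraph (@le_trans _ _ (objective r)%:E) ?lee_fin//.
by apply: ereal_inf_lbound; exists r; rewrite //= in_itv /= ltW.
Qed.

(** At equality the objective is pointwise [a psi], and a positive factor commutes with the
    infimum. *)
Lemma inf_on_epigraph_critical : beta = a * L ->
  inf_on C (ell a b) = (a%:E * gap_limit phi L)%E.
Proof.
move=> bL; rewrite inf_on_epigraph gap_limitE// -ereal_inf_pZl//.
rewrite image_comp; congr ereal_inf; apply: eq_imagel => r _ /=.
by rewrite -EFinM bL /recession_gap mulrBr mulrA.
Qed.

Lemma attained_on_epigraph_critical : beta = a * L ->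
  attained_on C (ell a b) <->
  exists2 r, 0 <= r & (recession_gap phi L r)%:E = gap_limit phi L.
Proof.
move=> bL; rewrite attained_on_epigraph inf_on_epigraph_critical// bL.
have gapE r :
    (a * phi r - a * L * r)%:E = (a%:E * (recession_gap phi L r)%:E)%E.
  by rewrite -EFinM /recession_gap mulrBr mulrA.
split=> -[r r0 rE]; exists r => //; last by rewrite gapE rE.
(* A finite [gamma] allows [a] to be cancelled; an infinite one makes [a gamma] infinite, which no
   real value equals. *)
move: rE; rewrite gapE; case: (gap_limit phi L) => [g||].
- by rewrite -!EFinM => -[/(mulfI (lt0r_neq0 a_gt0)) ->].
- by rewrite gt0_muley// lte_fin.
- by rewrite gt0_muleNy// lte_fin.
Qed.

Lemma attained_on_epigraph_subcritical : beta < a * L ->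
  attained_on C (ell a b).
Proof.
move=> bL; apply/attained_on_epigraph.
have [r r0 rmin] := profile_scalar_min prof a_gt0 bL.
exists r => //; apply/eqP; rewrite eq_le inf_on_epigraph; apply/andP; split.
  apply: le_ereal_inf_tmp => _ [s /= + <-]; rewrite in_itv andbT /= => s0.
  by rewrite lee_fin rmin.
by apply: ereal_inf_lbound; exists r; rewrite //= in_itv /= r0.
Qed.

End Epigraph.

(** * Three profiles separating the behaviours at equality *)

Section Examples.
Set Implicit Arguments.
Unset Strict Implicit.
Context {R : realType}.

(** Dividing the growth bound by [r] yields the slope limit, so each example only has to verify
    inequalities. *)
Lemma profileP (phi : R -> R) (L : R) : 0 < L ->
  (forall x y t, 0 <= x -> 0 <= y -> 0 <= t <= 1 ->
     phi (t * x + (1 - t) * y) <= t * phi x + (1 - t) * phi y) ->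
  (forall r s, 0 <= r -> r <= s -> phi r <= phi s) ->
  (forall e, 0 < e -> exists c, forall r, 0 <= r ->
     `|phi r - L * r| <= e * r + c) ->
  profile phi L.
Proof.
move=> L0 cvx mono growth; split => //.
- move=> t x y; rewrite !inE /= !in_itv /= !andbT => x0 y0.
  by apply: cvx => //; rewrite ge0 le1.
- by move=> r s; rewrite !in_itv /= !andbT => r0 _ /mono; apply.
- apply/cvgrPdist_le => e e0.
  (* Half of [e] bounds the linear term; the other half absorbs [c / r] for large [r]. *)
  have e2 : 0 < e / 2 by rewrite divr_gt0.
  have [c phic] := growth _ e2; near=> r.
  have r0 : 0 < r by [].
  have cr : c / (e / 2) <= r.
    by near: r; apply: nbhs_pinfty_ge; exact: num_real.
  rewrite distrC -(ler_pM2r r0) -[X in _ * X <= _](gtr0_norm r0) -normrM.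
  rewrite mulrBl divfK ?gt_eqF//.
  have := phic _ (ltW r0); move: cr; rewrite ler_pdivrMr// => cr.
  by move=> /le_trans; apply; lra.
Unshelve. all: end_near. Qed.

Lemma linear_profile (L : R) : 0 < L -> profile ( *%R L) L.
Proof.
move=> L0; apply: profileP => //.
- by move=> x y t *; rewrite mulrDr ![L * (_ * _)]mulrCA.
- by move=> r s _; rewrite ler_pM2l.
- by move=> e e0; exists 0 => r r0; rewrite subrr normr0 addr0 mulr_ge0// ltW.
Qed.

(** Here the gap is [L / (1 + r)], bounded below and strictly decreasing. *)
Lemma inv_profile (L : R) : 0 < L -> profile (fun r => L * (r + (1 + r)^-1)) L.
Proof.
move=> L0; apply: profileP => //.
- move=> x y t x0 y0 /andP[t0 t1].
  have x1 : 0 < 1 + x by lra.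
  have y1 : 0 < 1 + y by lra.
  have -> : 1 + (t * x + (1 - t) * y) = t * (1 + x) + (1 - t) * (1 + y) by ring.
  have xy1 : 0 < t * (1 + x) + (1 - t) * (1 + y) by nra.
  (* Convexity of the inverse: the deficit is an explicit fraction with a square in the
     numerator. *)
  suff : (t * (1 + x) + (1 - t) * (1 + y))^-1 <=
      t * (1 + x)^-1 + (1 - t) * (1 + y)^-1.
    by move=> /(ler_wpM2l (ltW L0)); lra.
  rewrite -subr_ge0.
  have -> : t * (1 + x)^-1 + (1 - t) * (1 + y)^-1 -
      (t * (1 + x) + (1 - t) * (1 + y))^-1 =
      t * (1 - t) * (x - y) ^+ 2 /
      ((1 + x) * (1 + y) * (t * (1 + x) + (1 - t) * (1 + y))).
    by field; rewrite !gt_eqF.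
  by rewrite divr_ge0 ?(mulr_ge0 _ (sqr_ge0 _)) ?mulr_ge0 ?subr_ge0// ltW.
- move=> r s r0 rs; rewrite ler_pM2l//.
  have r1 : 0 < 1 + r by lra.
  have s1 : 0 < 1 + s by lra.
  rewrite -subr_ge0.
  have -> : s + (1 + s)^-1 - (r + (1 + r)^-1) =
      (s - r) * ((1 + r) * (1 + s) - 1) / ((1 + r) * (1 + s)).
    by field; rewrite !gt_eqF.
  have rs1 : 1 <= (1 + r) * (1 + s) by nra.
  by rewrite divr_ge0 ?mulr_ge0 ?subr_ge0// ltW.
- move=> e e0; exists L => r r0.
  have i0 : 0 <= (1 + r)^-1 by rewrite invr_ge0; lra.
  have i1 : (1 + r)^-1 <= 1 by rewrite invf_le1; lra.
  have -> : L * (r + (1 + r)^-1) - L * r = L * (1 + r)^-1 by ring.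
  by rewrite ger0_norm ?mulr_ge0 ?(ltW L0)//; nra.
Qed.

(** Here the gap is [- 2 L sqrt (1 + r)], unbounded below yet sublinear. *)
Lemma sqrt_profile (L : R) : 0 < L ->
  profile (fun r => L * (r - 2 * Num.sqrt (1 + r))) L.
Proof.
move=> L0; apply: profileP => //.
- move=> x y t x0 y0 /andP[t0 t1].
  have u2 : Num.sqrt (1 + x) ^+ 2 = 1 + x by rewrite sqr_sqrtr; lra.
  have v2 : Num.sqrt (1 + y) ^+ 2 = 1 + y by rewrite sqr_sqrtr; lra.
  have u0 := sqrtr_ge0 (1 + x); have v0 := sqrtr_ge0 (1 + y).
  set u := Num.sqrt (1 + x) in u2 u0 *; set v := Num.sqrt (1 + y) in v2 v0 *.
  (* Concavity of the square root, obtained by comparing squares. *)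
  suff : t * u + (1 - t) * v <= Num.sqrt (1 + (t * x + (1 - t) * y)).
    by move=> /(ler_wpM2l (ltW L0)); lra.
  have uv0 : 0 <= t * u + (1 - t) * v by rewrite addr_ge0 ?mulr_ge0 ?subr_ge0.
  rewrite -[leLHS](ger0_norm uv0) -sqrtr_sqr; apply: ler_wsqrtr.
  have -> : 1 + (t * x + (1 - t) * y) = t * u ^+ 2 + (1 - t) * v ^+ 2.
    by rewrite u2 v2; ring.
  rewrite -subr_ge0.
  have -> : t * u ^+ 2 + (1 - t) * v ^+ 2 - (t * u + (1 - t) * v) ^+ 2
      = t * (1 - t) * (u - v) ^+ 2 by ring.
  by rewrite mulr_ge0 ?sqr_ge0 ?mulr_ge0 ?subr_ge0.
- move=> r s r0 rs; rewrite ler_pM2l//.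
  have u2 : Num.sqrt (1 + r) ^+ 2 = 1 + r by rewrite sqr_sqrtr; lra.
  have v2 : Num.sqrt (1 + s) ^+ 2 = 1 + s by rewrite sqr_sqrtr; lra.
  (* With [u = sqrt (1 + r)] the profile is [L ((u - 1)^2 - 2)], increasing for [u >= 1]; the shift
     by [1] under the root secures this range. *)
  have u1 : 1 <= Num.sqrt (1 + r) by rewrite -[leLHS]sqrtr1 ler_wsqrtr//; lra.
  have uv : Num.sqrt (1 + r) <= Num.sqrt (1 + s) by rewrite ler_wsqrtr//; lra.
  by nra.
- (* [2 sqrt (1 + r) <= d (1 + r) + 1 / d] with [d = e / L] *)
  move=> e e0; exists (e + L ^+ 2 / e) => r r0.
  have u2 : Num.sqrt (1 + r) ^+ 2 = 1 + r by rewrite sqr_sqrtr; lra.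
  have u0 := sqrtr_ge0 (1 + r); set u := Num.sqrt (1 + r) in u2 u0 *.
  have -> : L * (r - 2 * u) - L * r = - (2 * L * u) by ring.
  rewrite normrN ger0_norm; last by nra.
  have -> : e * r + (e + L ^+ 2 / e) = e * u ^+ 2 + L ^+ 2 / e.
    by rewrite u2; ring.
  rewrite -subr_ge0.
  have -> : e * u ^+ 2 + L ^+ 2 / e - 2 * L * u = (e * u - L) ^+ 2 / e.
    by field; rewrite gt_eqF.
  by rewrite divr_ge0 ?sqr_ge0// ltW.
Qed.

Lemma sqrt_profile_gap (L : R) : 0 < L ->
  gap_limit (fun r => L * (r - 2 * Num.sqrt (1 + r))) L = -oo%E.
Proof.
move=> L0; rewrite (gap_limitE (sqrt_profile L0)); apply: eq_ninfty => M.
(* Chosen so that [sqrt (1 + r) >= |M| / L], hence the gap is at most [- 2 |M|]. *)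
pose r := (M / L) ^+ 2; have r0 : 0 <= r by exact: sqr_ge0.
apply: (@le_trans _ _ (recession_gap
  (fun r => L * (r - 2 * Num.sqrt (1 + r))) L r)%:E).
  by apply: ereal_inf_lbound; exists r; rewrite //= in_itv /= r0.
rewrite lee_fin /recession_gap.
have -> : L * (r - 2 * Num.sqrt (1 + r)) - L * r = - (2 * L * Num.sqrt (1 + r)).
  by ring.
have : `|M / L| <= Num.sqrt (1 + r).
  by rewrite -sqrtr_sqr ler_wsqrtr// lerDr.
rewrite normrM normfV (gtr0_norm L0) ler_pdivrMr// => h.
have : - M <= `|M| by rewrite -normrN ler_norm.
by have := normr_ge0 M; lra.
Qed.

Lemma inv_profile_gap_fin_num (L : R) : 0 < L ->
  gap_limit (fun r => L * (r + (1 + r)^-1)) L \is a fin_num.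
Proof.
move=> L0; have prof := inv_profile L0.
rewrite fin_numElt (gap_limit_lty prof) andbT (gap_limitE prof).
apply: (@lt_le_trans _ _ 0%E) => //; apply: le_ereal_inf_tmp => _ [r /= + <-].
rewrite in_itv andbT /= lee_fin /recession_gap => r0.
by rewrite mulrDr addrC addKr mulr_ge0 ?invr_ge0 ?ltW//; lra.
Qed.

Lemma inv_profile_gap_unattained (L : R) : 0 < L ->
  let phi r := L * (r + (1 + r)^-1) in
  ~ exists2 r, 0 <= r & (recession_gap phi L r)%:E = gap_limit phi L.
Proof.
move=> L0 phi [r r0]; rewrite (gap_limitE (inv_profile L0)) => psir.
(* An infimum attained at [r] would be undercut at [r + 1] by the strict decrease of the gap. *)
have : recession_gap phi L r <= recession_gap phi L (r + 1).
  rewrite -lee_fin psir; apply: ereal_inf_lbound; exists (r + 1) => //=.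
  by rewrite in_itv /=; lra.
rewrite leNgt /recession_gap /phi => /negP; apply.
have r1 : 0 < 1 + r by lra.
have : (1 + (r + 1))^-1 < (1 + r)^-1 by rewrite ltf_pV2 ?posrE; lra.
by nra.
Qed.

End Examples.

(** Indecision at equality is expressed by witnesses sharing one slope [L]; the existence of [b]
    keeps that clause from being vacuous. *)
Theorem theorem5p2 (R : realType) (X : vectType R) (rho : X -> R)
    (X_neq0 : (0 < \dim {:X})%N) (rho_norm : is_norm rho) :
  (forall (phi : R -> R) (L : R), profile phi L ->
     let C := norm_epigraph phi rho in
     let psi := recession_gap phi L in
     let gamma := gap_limit phi L in
     [/\ {in `[0, +oo[ &, nonincreasing_fun psi},
         (psi r)%:E @[r --> +oo] --> gamma,
         (gamma < +oo)%E
       & recession_cone C = [set p | L * rho p.2 <= p.1]] /\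
     forall (a : R) (b : 'Hom(X, R^o)), 0 < a ->
       let beta := dual_norm rho b in
       [/\ inf_on C (ell a b) =
             inf_on `[0, +oo[%classic (fun r => a * phi r - beta * r),
           a * L < beta -> inf_on C (ell a b) = -oo%E,
           beta < a * L ->
             (a * phi r - beta * r @[r --> +oo] --> +oo) /\
             attained_on C (ell a b),
           beta = a * L ->
             [/\ inf_on C (ell a b) = (a%:E * gamma)%E,
                 gamma = -oo%E -> unbounded_below_on C (ell a b),
                 gamma \is a fin_num ->
                   (attained_on C (ell a b) <->
                      exists2 r, 0 <= r & (psi r)%:E = gamma) /\
                   ((exists2 r, 0 <= r & (psi r)%:E = gamma) <->
                      eventually_affine phi L)
               & gamma \is a fin_num ->
                   ~ (exists2 r, 0 <= r & (psi r)%:E = gamma) ->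
                   inf_on C (ell a b) \is a fin_num /\
                   ~ attained_on C (ell a b)]
         & copositive (ell a b) (recession_cone C) <-> beta <= a * L]) /\
  (forall a L : R, 0 < a -> 0 < L ->
     (exists b : 'Hom(X, R^o), dual_norm rho b = a * L) /\
     forall b : 'Hom(X, R^o), dual_norm rho b = a * L ->
       [/\ exists phi : R -> R,
             [/\ profile phi L,
                 copositive (ell a b) (recession_cone (norm_epigraph phi rho))
               & unbounded_below_on (norm_epigraph phi rho) (ell a b)],
           exists phi : R -> R,
             [/\ profile phi L,
                 copositive (ell a b) (recession_cone (norm_epigraph phi rho)),
                 inf_on (norm_epigraph phi rho) (ell a b) \is a fin_num
               & ~ attained_on (norm_epigraph phi rho) (ell a b)]
         & exists phi : R -> R,
             [/\ profile phi L,
                 copositive (ell a b) (recession_cone (norm_epigraph phi rho))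
               & attained_on (norm_epigraph phi rho) (ell a b)]]).
Proof.
split => [phi L prof C psi gamma|a L a_gt0 L_gt0].
- split.
    split.
    + move=> r s; rewrite !in_itv /= !andbT => r0 _.
      exact: recession_gap_nonincr.
    + by rewrite /gamma gap_limitE//; exact: recession_gap_cvg.
    + exact: gap_limit_lty prof.
    + exact: recession_cone_epigraph.
  move=> a b a_gt0 beta; split.
  + exact: inf_on_epigraph.
  + exact: inf_on_epigraph_supercritical.
  + move=> bL; split; first exact: profile_coercive prof _ _ a_gt0 bL.
    exact: attained_on_epigraph_subcritical prof _ _ a_gt0 bL.
  + move=> bL.
    have infE := inf_on_epigraph_critical rho_norm X_neq0 prof a_gt0 bL.
    have attE := attained_on_epigraph_critical rho_norm X_neq0 prof a_gt0 bL.
    split=> [//|gammaE|_|gamma_fin unatt].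
    * apply: unbounded_below_inf_on; rewrite infE -/gamma gammaE.
      by rewrite gt0_muleNy// lte_fin.
    * by split=> //; exact: gap_attainedP.
    * by rewrite infE fin_numM//; split => // /attE.
  + exact: copositive_ell.
- split; first by apply: dual_norm_surjective => //; rewrite mulr_ge0 ?ltW.
  move=> b bL.
  (* Copositivity depends on the profile only through [L], so one argument serves all three
     examples. *)
  have cop phi : profile phi L ->
      copositive (ell a b) (recession_cone (norm_epigraph phi rho)).
    move=> prof; apply/(copositive_ell rho_norm X_neq0 prof a_gt0).
    by rewrite bL.
  split.
  + have prof := sqrt_profile L_gt0.
    eexists; split; [exact: prof|exact: cop|].
    apply: unbounded_below_inf_on.
    rewrite (inf_on_epigraph_critical rho_norm X_neq0 prof a_gt0 bL).
    by rewrite sqrt_profile_gap// gt0_muleNy// lte_fin.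
  + have prof := inv_profile L_gt0.
    eexists; split; [exact: prof|exact: cop| |].
      rewrite (inf_on_epigraph_critical rho_norm X_neq0 prof a_gt0 bL).
      by rewrite fin_numM// inv_profile_gap_fin_num.
    move=> /(attained_on_epigraph_critical rho_norm X_neq0 prof a_gt0 bL).
    exact: inv_profile_gap_unattained.
  + have prof := linear_profile L_gt0.
    eexists; split; [exact: prof|exact: cop|].
    apply/(attained_on_epigraph_critical rho_norm X_neq0 prof a_gt0 bL).
    (* This [0] is the constant of the affine tail, not a minimizer. *)
    apply/(gap_attainedP prof); exists 0.
    by apply: nearW => r; rewrite addr0.
Qed.
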